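(* Let $f=p/q$ be a rational function on the standard simplex $\Delta\subset\mathbb{R}^n$, where $p,q$ are polynomials of total degree $l$, and suppose $b_\alpha(q,j,\Delta)>0$ for all $|\alpha|=j$ and all $j\ge l$. Then for every integer $k>l$, \[ d\big(f(\Delta),\,B(f,k,\Delta)\big)\le \frac{\omega}{k-1}, \] where \[ \omega:=\frac{n(n+2)\,l(l-1)}{24\,\min_{|\alpha|=l} b_\alpha(q,l,\Delta)}\Big(\|\nabla^2 p\|_\infty+\zeta\,\|\nabla^2 q\|_\infty\Big),\qquad \zeta:=\max\Big\{\big|\min_{|\alpha|=l} b_\alpha(f,l,\Delta)\big|,\ \big|\max_{|\alpha|=l} b_\alpha(f,l,\Delta)\big|\Big\}. \]
   Context: $\Delta=[e_0,e_1,\dots,e_n]$ is the standard simplex in $\mathbb{R}^n$ ($e_0$ the origin, $e_1,\dots,e_n$ the canonical basis), with barycentric coordinates $\lambda=(\lambda_0,\dots,\lambda_n)=(1-\sum_i x_i,x_1,\dots,x_n)$. For $\alpha\in\mathbb{N}^{n+1}$, $|\alpha|=\alpha_0+\dots+\alpha_n$. The Bernstein polynomials of degree $k$ on $\Delta$ are $B^{(k)}_\alpha=\frac{k!}{\alpha_0!\cdots\alpha_n!}\lambda^\alpha$, $|\alpha|=k$. A polynomial $p$ of degree $l\le k$ is uniquely written $p=\sum_{|\alpha|=k} b_\alpha(p,k,\Delta)B^{(k)}_\alpha$; the $b_\alpha(p,k,\Delta)$ are its Bernstein coefficients of degree $k$. For $f=p/q$ (numerator and denominator of the same degree $l$), the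 rational Bernstein coefficients are $b_\alpha(f,k,\Delta)=b_\alpha(p,k,\Delta)/b_\alpha(q,k,\Delta)$, and $B(f,k,\Delta):=[\min_{|\alpha|=k}b_\alpha(f,k,\Delta),\max_{|\alpha|=k}b_\alpha(f,k,\Delta)]$. $f(\Delta)=[\min_{\Delta}f,\max_\Delta f]$. For intervals, $d([\underline a,\overline a],[\underline b,\overline b])=\max\{|\underline a-\underline b|,|\overline a-\overline b|\}$. Second differences: with $\hat e_0,\dots,\hat e_n$ the unit vectors of $\mathbb{R}^{n+1}$ and convention $\hat e_{-1}:=\hat e_n$, for $\gamma\in\mathbb{N}^{n+1}$, $|\gamma|=l-2$, $0\le i<j\le n$, set $\nabla^2 b_{\gamma,i,j}(p,l,\Delta)=b_{\gamma+\hat e_i+\hat e_{j-1}}+b_{\gamma+\hat e_{i-1}+\hat e_j}-b_{\gamma+\hat e_{i-1}+\hat e_{j-1}}-b_{\gamma+\hat e_i+\hat e_j}$ (coefficients $b=b(p,l,\Delta)$), and $\|\nabla^2 p\|_\infty:=\max_{|\gamma|=l-2,\,0\le i<j\le n}|\nabla^2 b_{\gamma,i,j}(p,l,\Delta)|$; similarly for $q$. *)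

(* Defs.v *)
From HB Require Import structures.
From mathcomp Require Import all_boot all_order all_algebra.
Set Implicit Arguments. Unset Strict Implicit. Unset Printing Implicit Defensive.
Import Order.TTheory GRing.Theory Num.Theory.
Local Open Scope ring_scope.

Section Bernstein.
Variable R : rcfType.
Variable n : nat.

Definition mindex := {ffun 'I_n.+1 -> nat}.
Definition expo := {ffun 'I_n -> nat}.

Definition mindices (k : nat) : seq mindex :=
  map (fun a : {ffun 'I_n.+1 -> 'I_k.+1} => ([ffun i => nat_of_ord (a i)] : mindex))
    (enum [pred a : {ffun 'I_n.+1 -> 'I_k.+1} | (\sum_i nat_of_ord (a i) == k)%N]).

Definition expos (l : nat) : seq expo :=
  map (fun a : {ffun 'I_n -> 'I_l.+1} => ([ffun i => nat_of_ord (a i)] : expo))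
    (enum [pred a : {ffun 'I_n -> 'I_l.+1} | (\sum_i nat_of_ord (a i) <= l)%N]).

Definition expo_deg (b : expo) : nat := (\sum_i b i)%N.

Definition poly_eval (l : nat) (c : expo -> R) (x : 'I_n -> R) : R :=
  \sum_(b <- expos l) c b * \prod_i x i ^+ b i.

Definition has_total_degree (l : nat) (c : expo -> R) : Prop :=
  exists2 b, b \in expos l & (expo_deg b = l) /\ c b != 0.

Definition in_simplex (x : 'I_n -> R) : Prop :=
  (forall i, 0 <= x i) /\ \sum_i x i <= 1.

Definition bary (x : 'I_n -> R) (i : 'I_n.+1) : R :=
  match unlift ord0 i with
  | None => 1 - \sum_j x j
  | Some j => x j
  end.

Definition bern (k : nat) (a : mindex) (x : 'I_n -> R) : R :=
  (k`!)%:R / (\prod_i (a i)`!)%:R * \prod_i bary x i ^+ a i.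

Definition is_bern_coeffs (k : nat) (P : ('I_n -> R) -> R) (b : mindex -> R) : Prop :=
  forall x, P x = \sum_(a <- mindices k) b a * bern k a x.

Definition minl (s : seq R) : R := foldr Num.min (head 0 s) s.
Definition maxl (s : seq R) : R := foldr Num.max (head 0 s) s.

(* unit vector e_i of N^{n+1}, with e_{-1} := e_n *)
Definition unitm (i : nat) : mindex := [ffun t : 'I_n.+1 => nat_of_bool (nat_of_ord t == i)].
Definition prevm (i : nat) : nat := if i == 0%N then n else i.-1.
Definition addm (a b : mindex) : mindex := [ffun t => (a t + b t)%N].

Definition nabla2 (b : mindex -> R) (g : mindex) (i j : nat) : R :=
  b (addm g (addm (unitm i) (unitm (prevm j))))
  + b (addm g (addm (unitm (prevm i)) (unitm j)))
  - b (addm g (addm (unitm (prevm i)) (unitm (prevm j))))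
  - b (addm g (addm (unitm i) (unitm j))).

(* ||nabla^2 p||_infty from the degree-l Bernstein coefficients b
   (max over |gamma| = l-2, 0 <= i < j <= n; 0 if this index set is empty) *)
Definition nabla2_norm (l : nat) (b : mindex -> R) : R :=
  let G := if (2 <= l)%N then mindices (l - 2) else [::] in
  let trip := flatten (map (fun g => flatten (map (fun i =>
                 map (fun j => (g, (i, j))) (iota 0 n.+1)) (iota 0 n.+1))) G) in
  foldr Num.max 0
    (map (fun t => `|nabla2 b t.1 t.2.1 t.2.2|)
         (filter (fun t => (t.2.1 < t.2.2)%N) trip)).

End Bernstein.

(* Main.v *)
Require Import Defs.
From HB Require Import structures.
From mathcomp Require Import all_boot all_order all_algebra all_fingroup.
From mathcomp Require Import ring zify.
Import Order.TTheory GRing.Theory Num.Theory.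
Local Open Scope ring_scope.
Set Implicit Arguments. Unset Strict Implicit.

(** Let x = a / k with |a| = k, N = n + 1, and call word a map from positions
    0 .. k-1 to the N letters. The degree k coefficient b_a(p, k) is the mean of
    b(p, l) at the letter counts of the first l positions of a word drawn
    uniformly among those with total letter counts a (l draws without
    replacement), whereas p(x) is the same mean for l draws with replacement.
    Pass from one scheme to the other one letter at a time. A letter drawn with
    replacement only matters when it repeats a position t < j, and swapping
    positions t and j of the word turns the error into half a second difference
    of b(p, l) along e_u - e_v. Such a difference is a sum of m (N - m) values of
    nabla2, where m = |u - v|, and the mean of m (N - m) over two independent
    letters is at most (N^2 - 1) / 6, since this kernel is of negative type with
    constant row sums. Summing j over j < l bounds |p(x) - b_a(p, k)|; the rational
    statement follows as f(x) - b_a(f) = (dp - b_a(f) dq) / q(x), where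
    dp = p(x) - b_a(p, k), dq = q(x) - b_a(q, k). *)

(** * Multi-indices: degree, enumeration, shifts by unit vectors *)

Section MultiIndices.
Variable n : nat.
Implicit Types (a b g : mindex n) (i j : 'I_n.+1).

Definition mdeg a : nat := (\sum_i a i)%N.
Definition zerom : mindex n := [ffun=> 0%N].

Lemma addmA a b g : addm a (addm b g) = addm (addm a b) g.
Proof. by apply/ffunP => t; rewrite !ffunE addnA. Qed.

Lemma addmC a b : addm a b = addm b a.
Proof. by apply/ffunP => t; rewrite !ffunE addnC. Qed.

Lemma add0m a : addm zerom a = a.
Proof. by apply/ffunP => t; rewrite !ffunE. Qed.

Lemma addmI a : injective (fun b => addm b a).
Proof.
move=> b g /ffunP e; apply/ffunP => t; move: (e t).
by rewrite !ffunE => /addIn.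
Qed.

Lemma mdegD a b : mdeg (addm a b) = (mdeg a + mdeg b)%N.
Proof. by rewrite -big_split; apply: eq_bigr => i _; rewrite ffunE. Qed.

Lemma mdeg_unitm i : mdeg (unitm n i) = 1%N.
Proof.
rewrite /mdeg (bigD1 i) //= big1 ?ffunE ?eqxx // => t ti.
by rewrite ffunE val_eqE (negPf ti).
Qed.

Lemma mdeg0 : mdeg zerom = 0%N.
Proof. by rewrite /mdeg big1 // => i _; rewrite ffunE. Qed.

Lemma mdeg_eq0 a : mdeg a = 0%N -> a = zerom.
Proof.
move/eqP; rewrite sum_nat_eq0 => /forallP h.
by apply/ffunP => i; rewrite ffunE; apply/eqP; apply: h.
Qed.

Lemma mem_mindices k a : (a \in mindices n k) = (mdeg a == k).
Proof.
apply/mapP/eqP => [[u]|<-].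
  rewrite mem_enum => /eqP su ->; rewrite -[RHS]su.
  by apply: eq_bigr => i _; rewrite ffunE.
have lea i : (a i < (mdeg a).+1)%N by rewrite ltnS /mdeg (bigD1 i) //= leq_addr.
exists [ffun i => Ordinal (lea i)].
  by rewrite mem_enum; apply/eqP; apply: eq_bigr => i _; rewrite ffunE.
by apply/ffunP => i; rewrite !ffunE.
Qed.

Lemma mindices_uniq k : uniq (mindices n k).
Proof.
rewrite map_inj_uniq ?enum_uniq // => u v /ffunP e.
by apply/ffunP => i; apply: val_inj; move: (e i); rewrite !ffunE.
Qed.

Lemma perm_mindices0 : perm_eq (mindices n 0) [:: zerom].
Proof.
apply: uniq_perm; rewrite ?mindices_uniq // => a.
rewrite mem_mindices inE; apply/eqP/eqP => [/mdeg_eq0 //|->].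
exact: mdeg0.
Qed.

(** Subtracting a unit vector inverts the shift. This is the change of index in the induction on the
    degree in [sum_monom]. *)
Lemma perm_mindicesS k i :
  perm_eq [seq a : mindex n <- mindices n k.+1 | (0 < a i)%N]
          [seq addm a (unitm n i) | a <- mindices n k].
Proof.
apply: uniq_perm.
- exact/filter_uniq/mindices_uniq.
- by rewrite map_inj_uniq ?mindices_uniq //; exact: addmI.
move=> a; rewrite mem_filter mem_mindices; apply/andP/mapP.
  case=> ai /eqP da.
  have ea : a = addm [ffun t => (a t - unitm n i t)%N] (unitm n i).
    apply/ffunP => t; rewrite !ffunE subnK //.
    by rewrite val_eqE; case: eqP => // ->.
  exists [ffun t => (a t - unitm n i t)%N] => //.
  move: da; rewrite mem_mindices {1}ea mdegD mdeg_unitm addn1.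
  by case=> ->.
case=> b; rewrite mem_mindices => /eqP db ->; split.
  by rewrite !ffunE eqxx addn1.
by rewrite mdegD mdeg_unitm db addn1.
Qed.

Lemma head_mindices k : exists a, a \in mindices n k.
Proof.
exists [ffun t => if t == ord0 then k else 0%N].
rewrite mem_mindices /mdeg (bigD1 ord0) //= big1 ?ffunE ?eqxx ?addn0 //.
by move=> t /negPf ti; rewrite ffunE ti.
Qed.

End MultiIndices.

(** * Iterated blending (de Casteljau) and the multinomial expansion *)

Section Blend.
Variables (R : rcfType) (n : nat).
Implicit Types (F G : mindex n -> R) (y : 'I_n.+1 -> R) (a g : mindex n).

(** One de Casteljau step: for nonnegative weights of sum 1, the mean of [F] after one more random
    letter. The sum of [y] is left free so that the integer weights [a i] can be used without
    dividing by k. *)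
Definition blend y F g : R := \sum_i y i * F (addm g (unitm n i)).

Definition monom y a : R :=
  ((mdeg a)`!)%:R / (\prod_i (a i)`!)%:R * \prod_i y i ^+ a i.

Lemma blend_lincomb y m F G c d g :
  iter m (blend y) (fun h => c * F h + d * G h) g =
  c * iter m (blend y) F g + d * iter m (blend y) G g.
Proof.
elim: m g => //= m IH g; rewrite /blend !mulr_sumr -big_split /=.
by apply: eq_bigr => i _; rewrite IH; ring.
Qed.

Lemma blend_ge0 y m F g : (forall i, 0 <= y i) ->
  (forall h, mdeg h = (m + mdeg g)%N -> 0 <= F h) -> 0 <= iter m (blend y) F g.
Proof.
move=> y0; elim: m g => /= [|m IH] g Fh; first by apply: Fh.
apply: sumr_ge0 => i _; apply: mulr_ge0 => //; apply: IH => h.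
by rewrite mdegD mdeg_unitm addn1 addnS => dh; apply: Fh.
Qed.

Lemma blend_const y m c g : \sum_i y i = 1 -> iter m (blend y) (fun=> c) g = c.
Proof.
move=> y1; elim: m g => //= m IH g; rewrite /blend.
by under eq_bigr => i _ do rewrite IH; rewrite -mulr_suml y1 mul1r.
Qed.

Lemma blendZ y m F c g :
  iter m (blend (fun i => c * y i)) F g = c ^+ m * iter m (blend y) F g.
Proof.
elim: m g => [|m IH] g /=; first by rewrite mul1r.
rewrite /blend mulr_sumr; apply: eq_bigr => i _.
by rewrite IH exprS; ring.
Qed.

Lemma monom_gt0 y a : (forall i, 0 < y i) -> 0 < monom y a.
Proof.
move=> y0; rewrite /monom !mulr_gt0 ?invr_gt0 ?ltr0n ?fact_gt0 //.
  by apply: prodn_gt0 => i; apply: fact_gt0.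
by apply: prodr_gt0 => i _; apply: exprn_gt0.
Qed.

Lemma monom_addm y a i :
  (a i).+1%:R * monom y (addm a (unitm n i)) =
  (mdeg a).+1%:R * (y i * monom y a).
Proof.
rewrite /monom mdegD mdeg_unitm addn1 factS natrM.
have ea t : t != i -> addm a (unitm n i) t = a t.
  by move=> ti; rewrite !ffunE val_eqE (negPf ti) addn0.
have ei : addm a (unitm n i) i = (a i).+1 by rewrite !ffunE eqxx addn1.
rewrite !(bigD1 (P := predT) i) //= ei.
rewrite (eq_bigr (fun t => ((a t)`!)%N)) => [|t /ea -> //].
rewrite (eq_bigr (fun t => y t ^+ a t) (P := fun t => t != i)) => [|t /ea -> //].
rewrite factS exprS !natrM.
set P := (\prod_(i0 < _ | _) _)%N.
have P0 : P%:R != 0 :> R.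
  by rewrite pnatr_eq0 -lt0n prodn_gt0 // => t; rewrite fact_gt0.
have f0 : (a i)`!%:R != 0 :> R by rewrite pnatr_eq0 -lt0n fact_gt0.
by field; rewrite P0 f0 nat1r pnatr_eq0.
Qed.

(** In degree k + 1, multiplying by k + 1, the sum of the [a i], splits each term over i; after the
    shift by [unitm n i], [monom_addm] turns the i-th part into a sum of degree k with the factor
    [y i]. *)
Lemma sum_monom y k F :
  \sum_(a <- mindices n k) F a * monom y a = iter k (blend y) F (zerom n).
Proof.
elim: k F => [|k IH] F.
  rewrite (perm_big _ (perm_mindices0 n)) big_seq1 /monom mdeg0 /=.
  by rewrite !big1 ?divr1 ?mulr1 // => i _; rewrite ffunE.
rewrite iterSr -IH.
have k0 : k.+1%:R != 0 :> R by rewrite pnatr_eq0.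
apply: (mulfI k0).
transitivity (\sum_i \sum_(a <- mindices n k.+1) (a i)%:R * (F a * monom y a)).
  rewrite exchange_big mulr_sumr [LHS]big_seq [RHS]big_seq; apply: eq_bigr => a.
  by rewrite mem_mindices => /eqP <-; rewrite -mulr_suml natr_sum.
rewrite mulr_sumr; under [RHS]eq_bigr => a _ do rewrite mulr_suml mulr_sumr.
rewrite [RHS]exchange_big; apply: eq_bigr => i _ /=.
transitivity (\sum_(a <- mindices n k.+1 | (0 < a i)%N) (a i)%:R * (F a * monom y a)).
  rewrite [RHS]big_mkcond; apply: eq_bigr => a _.
  by case: posnP => // ->; rewrite mul0r.
rewrite -[LHS]big_filter (perm_big _ (perm_mindicesS k i)) big_map [LHS]big_seq [RHS]big_seq.
apply: eq_bigr => a; rewrite mem_mindices => /eqP da.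
rewrite mulrCA !ffunE eqxx addn1 monom_addm da; ring.
Qed.

End Blend.

(** * Words and their letter counts, to be told apart by digits in a fixed base *)

Lemma digits_inj N B (u v : 'I_N -> nat) :
  (forall i, u i < B)%N -> (forall i, v i < B)%N ->
  (\sum_i u i * B ^ i = \sum_i v i * B ^ i)%N -> u =1 v.
Proof.
elim: N u v => [|N IH] u v uB vB; first by move=> _ [].
rewrite !big_ord_recl !muln1.
have shift (f : 'I_N.+1 -> nat) :
    (\sum_(i < N) f (lift ord0 i) * B ^ bump 0 i =
     (\sum_(i < N) f (lift ord0 i) * B ^ i) * B)%N.
  by rewrite big_distrl; apply: eq_bigr => i _; rewrite /bump add1n expnSr mulnA.
rewrite !shift => e.
have B0 : (0 < B)%N by apply: leq_ltn_trans (uB ord0).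
have e0 : u ord0 = v ord0.
  have := congr1 (modn^~ B) e.
  by rewrite /= ![(_ + _ * B)%N]addnC !modnMDl !modn_small.
have eS : (fun i => u (lift ord0 i)) =1 (fun i => v (lift ord0 i)).
  apply: IH => [i|i|]; rewrite ?uB ?vB //.
  by move/eqP: e; rewrite e0 eqn_add2l eqn_pmul2r // => /eqP.
move=> i; case: (unliftP ord0 i) => [j ->|->] //; exact: eS.
Qed.

Section Words.
Variables (n k : nat).
Implicit Types (w : {ffun 'I_k -> 'I_n.+1}) (P : pred 'I_k) (a : mindex n).

(** A predicate on positions, not just a length, allows an initial segment with one position
    removed, as needed when positions are swapped. *)
Definition wcount w P : mindex n := [ffun i => (\sum_(t | P t) (w t == i))%N].

Lemma eq_wcount w P Q : P =1 Q -> wcount w P = wcount w Q.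
Proof. by move=> e; apply/ffunP => i; rewrite !ffunE; apply: eq_bigl. Qed.

Lemma wcountD1 w P t : P t ->
  wcount w P = addm (wcount w (fun s => P s && (s != t))) (unitm n (w t)).
Proof.
move=> Pt; apply/ffunP => i.
by rewrite !ffunE (bigD1 t) //= addnC val_eqE eq_sym [i == _]eq_sym.
Qed.

Lemma sum_wcount (S : pzSemiRingType) w P (f : 'I_n.+1 -> S) :
  \sum_(t | P t) f (w t) = \sum_i (wcount w P i)%:R * f i.
Proof.
under [RHS]eq_bigr => i _ do rewrite ffunE natr_sum mulr_suml.
rewrite exchange_big; apply: eq_bigr => t _.
rewrite (bigD1 (w t)) //= eqxx mul1r big1 ?addr0 // => i /negPf it.
by rewrite eq_sym it mul0r.
Qed.

Lemma mdeg_wcount w P : mdeg (wcount w P) = #|P|.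
Proof.
rewrite -sum1_card /mdeg -[LHS]natn natr_sum.
have := sum_wcount (S := nat) w P (fun=> 1).
by under [in RHS]eq_bigr => i _ do rewrite mulr1.
Qed.

Lemma wcount_perm w (s : {perm 'I_k}) P :
  wcount [ffun t => w (s t)] P = wcount w (fun t => P ((s^-1)%g t)).
Proof.
apply/ffunP => i; rewrite !ffunE [RHS](reindex_perm s).
by apply: eq_big => [t|t _]; rewrite ?permK // ffunE.
Qed.

(** Exchangeability of the draws: permuting positions keeps the total letter counts, so it permutes
    the range of summation. *)
Lemma sum_words_perm (V : nmodType) (s : {perm 'I_k}) a
    (G : {ffun 'I_k -> 'I_n.+1} -> V) :
  \sum_(w | wcount w predT == a) G w =
  \sum_(w | wcount w predT == a) G [ffun t => w (s t)].
Proof.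
rewrite (reindex_onto (fun w => [ffun t => w (s t)])
  (fun w => [ffun t => w ((s^-1)%g t)])) /= => [|w _].
  apply: eq_bigl => w; rewrite wcount_perm -[RHS]andbT; congr (_ && _).
  by apply/eqP/ffunP => t; rewrite !ffunE permKV.
by apply/ffunP => t; rewrite !ffunE permK.
Qed.

End Words.

(** * Sums over words weighted by the product of their letters *)

Section WordSums.
Variables (R : rcfType) (n : nat).
Implicit Types (F : mindex n -> R) (y : 'I_n.+1 -> R) (g : mindex n).

Definition wcons k (i : 'I_n.+1) (w : {ffun 'I_k -> 'I_n.+1}) :
    {ffun 'I_k.+1 -> 'I_n.+1} :=
  [ffun t => oapp w i (unlift ord0 t)].

Lemma sum_wcons k (G : {ffun 'I_k.+1 -> 'I_n.+1} -> R) :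
  \sum_w G w = \sum_i \sum_w G (wcons i w).
Proof.
rewrite pair_big /= (reindex (fun p => wcons p.1 p.2)) //=.
exists (fun w => (w ord0, [ffun t => w (lift ord0 t)])) => [[i w] _|w _] /=.
  by rewrite ffunE unlift_none; congr pair; apply/ffunP => t; rewrite !ffunE liftK.
by apply/ffunP => t; rewrite ffunE; case: unliftP => [j ->|->] //=; rewrite ffunE.
Qed.

(** Each of the first j letters is one blending step; each later letter sums out to a factor
    [\sum_i y i]. The induction removes the first letter, which moves into [g] when j > 0. *)
Lemma word_sum k j y F g : (j <= k)%N ->
  \sum_(w : {ffun 'I_k -> 'I_n.+1})
     (\prod_t y (w t)) * F (addm g (wcount w (fun t => t < j)%N)) =
  (\sum_i y i) ^+ (k - j) * iter j (blend y) F g.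
Proof.
elim: k j g => [|k IH] j g.
  rewrite leqn0 => /eqP ->; rewrite mul1r.
  rewrite (big_pred1 [ffun=> ord0]) => [|w].
    rewrite big_ord0 mul1r /=; congr F; apply/ffunP => i.
    by rewrite !ffunE big_ord0 addn0.
  by apply/esym/eqP/ffunP; case.
rewrite sum_wcons => jk.
have prodE i (w : {ffun 'I_k -> 'I_n.+1}) :
    \prod_t y (wcons i w t) = y i * \prod_t y (w t).
  rewrite big_ord_recl ffunE unlift_none; congr (_ * _).
  by apply: eq_bigr => t _; rewrite ffunE liftK.
case: j jk => [_|j].
  have zE k' (w : {ffun 'I_k' -> 'I_n.+1}) : wcount w (fun t => t < 0)%N = zerom n.
    by apply/ffunP => i; rewrite !ffunE big_pred0.
  rewrite subn0 exprS -mulrA mulr_suml; apply: eq_bigr => i _.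
  rewrite -[k in _ ^+ k]subn0 -(IH 0%N) // mulr_sumr.
  by apply: eq_bigr => w _; rewrite prodE !zE mulrA.
rewrite ltnS => jk; rewrite iterS /blend mulr_sumr subSS.
apply: eq_bigr => i _; rewrite mulrCA -(IH j) // mulr_sumr.
apply: eq_bigr => w _; rewrite prodE -!mulrA -addmA; congr (_ * (_ * F (addm _ _))).
apply/ffunP => u; rewrite !ffunE big_mkcond big_ord_recl ffunE unlift_none /=.
rewrite eq_sym val_eqE; congr (_ + _)%N.
by rewrite [RHS]big_mkcond; apply: eq_bigr => t _; rewrite ffunE liftK.
Qed.

(** Kronecker substitution: for y i proportional to T to the power (k + 1)^i, a word has as weight,
    up to a common factor, a power of T whose exponent encodes the letter counts in base k + 1. The
    hypothesis becomes a polynomial identity in T, whose coefficients are the sums over words of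
    equal counts. *)
Lemma sum_words_eq0 k (G : {ffun 'I_k -> 'I_n.+1} -> R) :
  (forall y, \sum_i y i = 1 ->
     \sum_(w : {ffun 'I_k -> 'I_n.+1}) (\prod_t y (w t)) * G w = 0) ->
  forall a, \sum_(w | wcount w predT == a) G w = 0.
Proof.
move=> G0 a.
case: (pickP (fun w : {ffun 'I_k -> 'I_n.+1} => wcount w predT == a))
  => [w0 /eqP w0a|none]; last by rewrite big_pred0.
pose e (w : {ffun 'I_k -> 'I_n.+1}) := (\sum_t k.+1 ^ w t)%N.
have eE w : (e w == e w0) = (wcount w predT == a).
  have dE (v : {ffun 'I_k -> 'I_n.+1}) : e v = (\sum_i wcount v predT i * k.+1 ^ i)%N.
    have := sum_wcount (S := nat) v predT (fun i => k.+1 ^ i)%N.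
    by under [in RHS]eq_bigr => i _ do rewrite natn.
  have dk (v : {ffun 'I_k -> 'I_n.+1}) i : (wcount v predT i < k.+1)%N.
    rewrite ltnS; apply: (@leq_trans (mdeg (wcount v predT))).
      by rewrite /mdeg (bigD1 i) //= leq_addr.
    by rewrite mdeg_wcount cardT size_enum_ord.
  apply/eqP/eqP => [|wa]; last by rewrite !dE wa -w0a.
  by rewrite !dE => /digits_inj h; rewrite -w0a; apply/ffunP; apply: h.
pose p : {poly R} := \sum_w G w *: 'X^(e w).
have p0 : p = 0.
  apply/eqP; apply: contraT => pN0.
  (* The points 1, ..., [size p] are one root too many for a nonzero polynomial. *)
  have := max_poly_roots (p := p) (rs := [seq i.+1%:R | i <- iota 0 (size p)]) pN0.
  rewrite size_map size_iota ltnn => -> //.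
    apply/allP => _ /mapP [i _ ->]; set T := i.+1%:R.
    have T0 : 0 < T :> R by rewrite ltr0n.
    (* Dividing by [S] makes the weights sum to 1; the k-th power of 1 / [S] is common to all words
       and cancels. *)
    pose S := \sum_(j < n.+1) T ^+ (k.+1 ^ j)%N.
    have S0 : 0 < S.
      rewrite /S big_ord_recl ltr_wpDr ?exprn_gt0 //.
      by apply: sumr_ge0 => j _; rewrite exprn_ge0 // ltW.
    have y1 : \sum_(j < n.+1) T ^+ (k.+1 ^ j)%N / S = 1.
      by rewrite -mulr_suml divff // gt_eqF.
    have := G0 _ y1.
    under eq_bigr => w _ do rewrite big_split /= prodr_const -expr_sum mulrAC.
    rewrite -mulr_suml => /eqP; rewrite mulf_eq0 expf_eq0 invr_eq0 (gt_eqF S0) andbF orbF.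
    move=> /eqP s0; apply/rootP; rewrite /p horner_sum -[RHS]s0.
    by apply: eq_bigr => w _; rewrite hornerZ hornerXn mulrC.
  rewrite map_inj_uniq ?iota_uniq // => i j /eqP.
  by rewrite eqr_nat => /eqP [].
have := congr1 (fun q : {poly R} => q`_(e w0)) p0.
rewrite coef0 coef_sum => c0; rewrite -[RHS]c0 [LHS]big_mkcond; apply: eq_bigr => w _.
rewrite coefZ coefXn [e w0 == _]eq_sym eE.
by case: ifP; rewrite ?mulr1 ?mulr0.
Qed.

(** By counting: [word_sum] at y = 1 for the indicator of [a] gives the multinomial coefficient,
    which is positive. *)
Lemma word_of_mindex k a : a \in mindices n k ->
  exists w : {ffun 'I_k -> 'I_n.+1}, wcount w predT == a.
Proof.
move=> ak; apply/existsP; apply: contraT => /existsPn none.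
have := word_sum (fun=> 1) (fun b => (b == a)%:R) (zerom n) (leqnn k).
rewrite subnn mul1r -sum_monom big1 => [|w _]; last first.
  by rewrite add0m (@eq_wcount _ _ w _ predT) ?(negPf (none w)) ?mulr0 // => t; rewrite ltn_ord.
rewrite (bigD1_seq a) ?mindices_uniq //= eqxx mul1r big1 => [/esym|b /negPf ->]; last first.
  by rewrite mul0r.
rewrite addr0 => m0.
by have := monom_gt0 (y := fun=> 1 : R) a (fun=> ltr01); rewrite m0 ltxx.
Qed.

End WordSums.

(** * The cyclic kernel: row sums, negative type, quadratic bound *)

Section CyclicKernel.
Variables (R : rcfType) (n : nat).

(* m * (n.+1 - m) with m = |a - c|, the product of the lengths of the two arcs
   into which a and c cut a cycle of n.+1 points. *)
Definition cyc (a c : nat) : R :=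
  n.+1%:R * `|a%:R - c%:R| - (a%:R - c%:R) ^+ 2.

Lemma cycC a c : cyc a c = cyc c a.
Proof. by rewrite /cyc distrC; ring. Qed.

Lemma cyc_le a c : (c <= a)%N ->
  cyc a c = (a%:R - c%:R) * (n.+1%:R - (a%:R - c%:R)).
Proof.
by move=> ca; rewrite /cyc ger0_norm ?subr_ge0 ?ler_nat //; ring.
Qed.

(** The kernel depends only on the cyclic distance, so every row sums to the sum of m (N - m) over m
    < N, with N = n + 1. *)
Lemma sum_cyc (a : 'I_n.+1) :
  \sum_(c < n.+1) cyc a c = n.+1%:R * (n.+1%:R ^+ 2 - 1) / 6%:R.
Proof.
pose N : R := n.+1%:R; pose A : R := a%:R.
(* Closed forms for initial sums of the two branches of the kernel; the part with c >= a is a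
   difference of two such sums. *)
have below m : \sum_(c < m) (A - c%:R) * (N - (A - c%:R)) =
    m%:R * (A * (N - A)) + m%:R * (m%:R - 1) / 2%:R * (2%:R * A - N)
    - m%:R * (m%:R - 1) * (2%:R * m%:R - 1) / 6%:R.
  elim: m => [|m IH]; first by rewrite big_ord0; ring.
  by rewrite big_ord_recr IH /= -natr1; field.
have above m : \sum_(c < m) (c%:R - A) * (N - (c%:R - A)) =
    - (m%:R * (A * (N + A))) + m%:R * (m%:R - 1) / 2%:R * (2%:R * A + N)
    - m%:R * (m%:R - 1) * (2%:R * m%:R - 1) / 6%:R.
  elim: m => [|m IH]; first by rewrite big_ord0; ring.
  by rewrite big_ord_recr IH /= -natr1; field.
have split_a : \sum_(c < n.+1) cyc a c =
    \sum_(c < a) (A - c%:R) * (N - (A - c%:R)) +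
    (\sum_(c < n.+1) (c%:R - A) * (N - (c%:R - A)) -
     \sum_(c < a) (c%:R - A) * (N - (c%:R - A))).
  rewrite -!(big_mkord predT (fun c => (c%:R - A) * (N - (c%:R - A)))).
  rewrite (big_cat_nat _ (n := a)) //=; last exact: ltnW.
  rewrite [X in _ + (X - _)]addrC addrK.
  rewrite -(big_mkord predT (fun c => cyc a c)) (big_cat_nat _ (n := a)) //=; last exact: ltnW.
  rewrite -(big_mkord predT (fun c => (A - c%:R) * (N - (A - c%:R)))).
  congr (_ + _).
    by rewrite [LHS]big_nat [RHS]big_nat; apply: eq_bigr => c /andP[_ /ltnW ca]; rewrite cyc_le.
  by rewrite [LHS]big_nat [RHS]big_nat; apply: eq_bigr => c /andP[ac _]; rewrite cycC cyc_le.
by rewrite split_a !below !above -/N -/A; field.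
Qed.

(* The kernel is a sum of squares of differences of [i <= a] - [j <= a], hence
   of negative type. *)
Lemma cyc_squares (a c : 'I_n.+1) :
  cyc a c = \sum_(i < n.+1) \sum_(j < n.+1)
    (((i <= a)%N%:R - (j <= a)%N%:R) - ((i <= c)%N%:R - (j <= c)%N%:R)) ^+ 2 / 2%:R.
Proof.
wlog ca : a c / (c <= a)%N.
  move=> h; case: (leqP c a) => [/h //|/ltnW /h e]; rewrite cycC e.
  by apply: eq_bigr => i _; apply: eq_bigr => j _; congr (_ / _); ring.
(* As c <= a, [u] is the indicator of ]c, a]: it and its square both sum to a - c, and the double
   sum is N (a - c) - (a - c)^2. *)
pose u (i : 'I_n.+1) : R := (i <= a)%N%:R - (i <= c)%N%:R.
have count (b : 'I_n.+1) : \sum_(i < n.+1) (i <= b)%N%:R = b.+1%:R :> R.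
  rewrite -natr_sum; congr _%:R; rewrite -[RHS]card_ord -sum1_card.
  rewrite -(big_mkord predT (fun i => nat_of_bool (i <= b)%N)) (big_cat_nat _ (n := b.+1)) //=.
  rewrite [X in (_ + X)%N]big_nat [X in (_ + X)%N]big1; last by move=> i /andP[bi _]; rewrite leqNgt bi.
  rewrite addn0 big_mkord; apply: eq_bigr => i _.
  by rewrite -ltnS ltn_ord.
have u1 : \sum_i u i = a%:R - c%:R.
  by rewrite sumrB !count -!natr1; ring.
have u2 : \sum_i u i ^+ 2 = a%:R - c%:R.
  rewrite -u1; apply: eq_bigr => i _; rewrite /u.
  case: (leqP i c) => [ic|_]; last by case: leqP => _; rewrite /=; ring.
  by rewrite (leq_trans ic ca) /=; ring.
rewrite cyc_le //.
transitivity (\sum_(i < n.+1) \sum_(j < n.+1)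
   ((u i ^+ 2 + u j ^+ 2) / 2%:R - u i * u j)); last first.
  by apply: eq_bigr => i _; apply: eq_bigr => j _; rewrite /u; field.
transitivity (\sum_(i < n.+1)
   (n.+1%:R * u i ^+ 2 / 2%:R + (a%:R - c%:R) / 2%:R - u i * (a%:R - c%:R))).
  rewrite sumrB big_split /= -!mulr_suml -!mulr_sumr u1 u2 sumr_const card_ord.
  by rewrite -[in RHS]mulr_natl; field.
apply: eq_bigr => i _; rewrite sumrB -mulr_sumr u1 -mulr_suml big_split /=.
by rewrite sumr_const card_ord u2 -[in RHS]mulr_natl; field.
Qed.

(** When the squares of [cyc_squares] are expanded, the pure squares come with the factor
    [\sum_a z a] = 0, and the cross terms form the opposite of a square. *)
Lemma cyc_negtype (z : 'I_n.+1 -> R) : \sum_a z a = 0 ->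
  \sum_a \sum_c z a * z c * cyc a c <= 0.
Proof.
move=> z0.
pose v (i j a : 'I_n.+1) : R := (i <= a)%N%:R - (j <= a)%N%:R.
have -> : \sum_a \sum_c z a * z c * cyc a c =
    \sum_(i < n.+1) \sum_(j < n.+1) - (\sum_a z a * v i j a) ^+ 2.
  transitivity (\sum_a \sum_c \sum_(i < n.+1) \sum_(j < n.+1)
      z a * z c * ((v i j a - v i j c) ^+ 2 / 2%:R)).
    apply: eq_bigr => a _; apply: eq_bigr => c _.
    rewrite cyc_squares mulr_sumr; apply: eq_bigr => i _.
    by rewrite mulr_sumr.
  under eq_bigr => a _ do rewrite exchange_big.
  rewrite exchange_big; apply: eq_bigr => i _ /=.
  under eq_bigr => a _ do rewrite exchange_big.
  rewrite exchange_big; apply: eq_bigr => j _ /=.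
  transitivity (\sum_a (z a * v i j a ^+ 2 / 2%:R * (\sum_c z c)
     + z a / 2%:R * (\sum_c z c * v i j c ^+ 2)
     - z a * v i j a * \sum_c z c * v i j c)).
    apply: eq_bigr => a _; rewrite !mulr_sumr -big_split -sumrB /=.
    by apply: eq_bigr => c _; field.
  rewrite sumrB big_split /= -!mulr_suml z0; ring.
apply: sumr_le0 => i _; apply: sumr_le0 => j _.
by rewrite oppr_le0 sqr_ge0.
Qed.

(** Negative type applied to y minus its mean; since the row sums are constant, the correction terms
    are multiples of the square of [\sum_a y a]. *)
Lemma cyc_quad (y : 'I_n.+1 -> R) :
  \sum_a \sum_c y a * y c * cyc a c <=
  (n.+1%:R ^+ 2 - 1) / 6%:R * (\sum_a y a) ^+ 2.
Proof.
pose S := \sum_a y a; pose N : R := n.+1%:R.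
have N0 : N != 0 by rewrite pnatr_eq0.
pose r := N * (N ^+ 2 - 1) / 6%:R.
have z0 : \sum_a (y a - S / N) = 0.
  by rewrite sumrB sumr_const card_ord -mulr_natr -/N -/S divfK ?subrr.
have := cyc_negtype z0.
have -> : \sum_a \sum_c (y a - S / N) * (y c - S / N) * cyc a c =
    \sum_a \sum_c y a * y c * cyc a c - S * (S / N) * r - (S / N) * S * r
    + (S / N) ^+ 2 * (N * r).
  transitivity (\sum_a \sum_c (y a * y c * cyc a c - y a * (S / N) * cyc a c
      - (S / N) * y c * cyc a c + (S / N) ^+ 2 * cyc a c)).
    by apply: eq_bigr => a _; apply: eq_bigr => c _; ring.
  have sc (x : R) : \sum_(a < n.+1) \sum_(c < n.+1) x * cyc a c = x * (N * r).
    under eq_bigr => a _ do rewrite -mulr_sumr sum_cyc.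
    by rewrite sumr_const card_ord -mulr_natr -/N /r; ring.
  have row : \sum_a \sum_(c < n.+1) y a * (S / N) * cyc a c = S * (S / N) * r.
    under eq_bigr => a _ do rewrite -mulr_sumr sum_cyc.
    by rewrite -!mulr_suml.
  have col : \sum_(a < n.+1) \sum_(c < n.+1) S / N * y c * cyc a c = S / N * S * r.
    rewrite exchange_big /=.
    under eq_bigr => c _ do
      (under eq_bigr => a _ do rewrite cycC; rewrite -mulr_sumr sum_cyc).
    by rewrite -mulr_suml -mulr_sumr.
  under eq_bigr => a _ do rewrite big_split /= sumrB sumrB.
  by rewrite big_split /= sumrB sumrB sc row col.
have -> : \sum_a \sum_c y a * y c * cyc a c - S * (S / N) * r - S / N * S * r +
   (S / N) ^+ 2 * (N * r) =
   \sum_a \sum_c y a * y c * cyc a c - (N ^+ 2 - 1) / 6%:R * S ^+ 2.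
  by rewrite /r; field; rewrite nat1r pnatr_eq0.
by rewrite subr_le0.
Qed.

End CyclicKernel.

(** * Second differences along e_a - e_c *)

Section SecondDifferences.
Variables (R : rcfType) (n : nat).
Implicit Types (F b : mindex n -> R) (g : mindex n) (a c : 'I_n.+1).

Definition diff2 F g a c : R :=
  F (addm g (addm (unitm n a) (unitm n a)))
  + F (addm g (addm (unitm n c) (unitm n c)))
  - 2%:R * F (addm g (addm (unitm n a) (unitm n c))).

Lemma diff2C F g a c : diff2 F g a c = diff2 F g c a.
Proof. by rewrite /diff2 [addm (unitm n c) (unitm n a)]addmC; ring. Qed.

Lemma nabla2_norm_ge l b g i j : (mdeg g + 2 = l)%N -> (i < j <= n)%N ->
  `|nabla2 b g i j| <= nabla2_norm l b.
Proof.
move=> dg /andP[ij jn]; rewrite /nabla2_norm -dg leq_addl addnK.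
set t := filter _ _; have : (g, (i, j)) \in t.
  rewrite mem_filter; apply/andP; split; first exact: ij.
  apply/flatten_mapP; exists g; first by rewrite mem_mindices.
  apply: (allpairs_f (fun i j => (g, (i, j)))); rewrite mem_iota add0n ltnS //=.
  exact: leq_trans (ltnW ij) jn.
elim: t => //= s t IH; rewrite inE le_max => /orP[/eqP <- /=|/IH ->].
  by rewrite lexx.
by rewrite orbT.
Qed.

Lemma nabla2_norm_ge0 l b : 0 <= nabla2_norm l b.
Proof.
rewrite /nabla2_norm; set t := filter _ _.
by elim: t => //= s t IH; rewrite le_max IH orbT.
Qed.

(* With d_i = e_i - e_(i-1) (indices on a cycle), e_a - e_c is the sum of the
   d_i over the arc I = ]c, a] and minus the sum of the d_j over the
   complementary arc, so the second difference along e_a - e_c is the sum of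
   nabla2 over I and its complement. *)
Lemma diff2_le F g M a c :
  (forall i j, (i < j <= n)%N -> `|nabla2 F g i j| <= M) ->
  `|diff2 F g a c| <= M * cyc R n a c.
Proof.
move=> FM; wlog ca : a c / (c <= a)%N.
  by move=> h; case: (leqP c a) => [/h //|/ltnW /h]; rewrite diff2C cycC.
pose h u v := F (addm g (addm (unitm n u) (unitm n v))).
have hC u v : h u v = h v u by rewrite /h [addm (unitm n u) _]addmC.
(* [f i] is the first difference along d_i; its difference along d_j is, up to sign, a value of
   [nabla2]. *)
pose f i v := h i v - h (prevm n i) v.
have fM i j : (i <= n)%N -> (j <= n)%N -> i != j -> `|f i (prevm n j) - f i j| <= M.
  move=> iN jN; rewrite neq_ltn => /orP[ij|ji].
    rewrite (_ : _ - _ = nabla2 F g i j); first by rewrite FM // ij.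
    by rewrite /f /nabla2 -!/(h _ _); ring.
  rewrite (_ : _ - _ = nabla2 F g j i); first by rewrite FM // ji.
  rewrite /f /nabla2 -!/(h _ _) (hC j) (hC (prevm n j) i).
  by rewrite (hC (prevm n j)) (hC j); ring.
(* The way from a up to n, around to 0 and up to c has (n - a) + 1 + c steps, and none of them is
   along d_i itself because c < i <= a. *)
have fcM i : (c < i <= a)%N -> `|f i a - f i c| <= M * (n.+1%:R - (a%:R - c%:R)).
  move=> /andP[ci ia]; have an : (a <= n)%N by rewrite -ltnS.
  have iN := leq_trans ia an.
  have up : `|f i a - f i n| <= M *+ (n - a).
    rewrite distrC -(telescope_sumr _ an) (le_trans (ler_norm_sum _ _ _)) //.
    rewrite -(sumr_const_nat n a M) !big_nat; apply: ler_sum => j /andP[aj jn].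
    by rewrite distrC; apply: (fM i j.+1) => //; rewrite neq_ltn ltnS (leq_trans ia aj).
  have wrap : `|f i n - f i 0%N| <= M.
    by apply: (fM i 0%N) => //; rewrite -lt0n (leq_ltn_trans _ ci).
  have low : `|f i 0%N - f i c| <= M *+ c.
    rewrite distrC -(telescope_sumr _ (leq0n c)) (le_trans (ler_norm_sum _ _ _)) //.
    rewrite -{2}[c : nat]subn0 -(sumr_const_nat c 0 M) !big_nat.
    apply: ler_sum => j /andP[_ jc]; rewrite distrC; apply: (fM i j.+1) => //.
      by rewrite (leq_trans jc) // (leq_trans ca).
    by rewrite neq_ltn (leq_ltn_trans jc ci) orbT.
  rewrite (_ : f i a - f i c = (f i a - f i n) + (f i n - f i 0%N) + (f i 0%N - f i c));
    last by ring.
  apply: le_trans (ler_normD _ _) _; apply: le_trans (lerD (ler_normD _ _) low) _.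
  apply: le_trans (lerD (lerD up wrap) (lexx _)) _.
  rewrite -(mulr_natr M (n - a)) -(mulr_natr M c) natrB // -natr1.
  by rewrite le_eqVlt; apply/orP; left; apply/eqP; ring.
have -> : diff2 F g a c = \sum_(c <= i < a) (f i.+1 a - f i.+1 c).
  rewrite /f sumrB !telescope_sumr // /diff2 -!/(h _ _) (hC c a); ring.
apply: le_trans (ler_norm_sum _ _ _) _; rewrite big_nat.
apply: (@le_trans _ _ (\sum_(c <= i < a | (c <= i < a)%N) M * (n.+1%:R - (a%:R - c%:R)))).
  by apply: ler_sum => i /andP[ci ia]; apply: fcM; rewrite ltnS ci.
rewrite -big_nat sumr_const_nat cyc_le // -(mulr_natr _ (a - c)) natrB //.
by rewrite le_eqVlt; apply/orP; left; apply/eqP; ring.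
Qed.

(** Blending combines translates with nonnegative weights, so it commutes with the second difference
    and costs a factor [\sum_i y i] per step. *)
Lemma diff2_blend y m l F B a c g :
  (forall i, 0 <= y i) ->
  (forall h, (mdeg h + 2 = l)%N -> `|diff2 F h a c| <= B) ->
  (mdeg g + 2 + m = l)%N ->
  `|diff2 (iter m (blend y) F) g a c| <= (\sum_i y i) ^+ m * B.
Proof.
move=> y0 FB; elim: m g => [|m IH] g; first by rewrite addn0 mul1r; apply: FB.
move=> dg.
have -> : diff2 (iter m.+1 (blend y) F) g a c =
    \sum_i y i * diff2 (iter m (blend y) F) (addm g (unitm n i)) a c.
  rewrite /diff2 /= /blend mulr_sumr -big_split -sumrB /=; apply: eq_bigr => i _.
  have sw u : addm (addm g u) (unitm n i) = addm (addm g (unitm n i)) u.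
    by rewrite -!addmA (addmC u).
  by rewrite !sw; ring.
apply: le_trans (ler_norm_sum _ _ _) _; rewrite exprS -mulrA mulr_suml.
apply: ler_sum => i _; rewrite normrM ger0_norm //.
by apply: ler_wpM2l => //; apply: IH; rewrite mdegD mdeg_unitm; lia.
Qed.

End SecondDifferences.

(** * Exchanging one draw with replacement for one without *)

Lemma card_ord_lt j k : (j <= k)%N -> #|fun t : 'I_k => (t < j)%N| = j.
Proof.
move=> jk; rewrite -sum1_card -[RHS]card_ord -[RHS]sum1_card.
by rewrite [RHS](big_ord_widen k (fun=> 1%N)).
Qed.

Section Exchange.
Variables (R : rcfType) (n k : nat) (a : mindex n).
Hypothesis ak : a \in mindices n k.
Implicit Types (w : {ffun 'I_k -> 'I_n.+1}) (F : mindex n -> R).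

Let words := [pred w : {ffun 'I_k -> 'I_n.+1} | wcount w predT == a].

Lemma sum_weight : \sum_i (a i)%:R = k%:R :> R.
Proof. by move: ak; rewrite mem_mindices => /eqP <-; rewrite natr_sum. Qed.

(** By exchangeability all k (k - 1) ordered pairs of distinct positions give the same sum, and the
    diagonal gives 0. For a single word, the sum over all pairs is the quadratic form of [cyc_quad]
    at the counts [a]. *)
Lemma sum_words_cyc (s t : 'I_k) : s != t ->
  \sum_(w in words) cyc R n (w s) (w t) <=
  #|words|%:R * (k%:R * (n.+1%:R ^+ 2 - 1) / (6%:R * (k%:R - 1))).
Proof.
move=> st; set Z := \sum_(w in words) _.
have ZE (s' t' : 'I_k) : s' != t' -> \sum_(w in words) cyc R n (w s') (w t') = Z.
  (* The first transposition takes s to s'; the second takes the image of t to t' and fixes s'. *)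
  move=> st'; rewrite /Z [RHS](sum_words_perm (tperm s s')).
  rewrite [RHS](sum_words_perm (tperm (tperm s s' t) t')).
  apply: eq_bigr => w _; rewrite !ffunE !tpermL [tperm _ t' s']tpermD //; last by rewrite eq_sym.
  by rewrite -[X in _ != X](tpermL s s') (inj_eq perm_inj) eq_sym.
have k2 : (1 < k)%N.
  rewrite ltnNge; apply: contra st => k1; rewrite -val_eqE /=.
  by have := ltn_ord s; have := ltn_ord t; lia.
have k1 : 0 < k%:R - 1 :> R by rewrite subr_gt0 ltr1n.
have tot : k%:R * ((k%:R - 1) * Z) =
    \sum_(w in words) \sum_s' \sum_t' cyc R n (w s') (w t').
  rewrite exchange_big /=; under eq_bigr => s' _ do rewrite exchange_big /=.
  transitivity (\sum_(s' < k) (k%:R - 1) * Z).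
    by rewrite sumr_const card_ord mulr_natl.
  apply: eq_bigr => s' _; rewrite (bigD1 s') //= big1 => [|w _]; last first.
    by rewrite /cyc subrr normr0 mulr0 expr0n subrr.
  rewrite add0r (eq_bigr (fun=> Z)) => [|t' ts]; last by rewrite ZE // eq_sym.
  rewrite sumr_const (eq_card (B := predC1 s')) // cardC1 card_ord -(mulr_natl Z).
  by rewrite -subn1 natrB // ltnW.
have le_w w : w \in words -> \sum_s' \sum_t' cyc R n (w s') (w t') <=
    (n.+1%:R ^+ 2 - 1) / 6%:R * k%:R ^+ 2.
  move=> /eqP wa.
  have -> : \sum_s' \sum_t' cyc R n (w s') (w t') =
      \sum_i \sum_j (a i)%:R * (a j)%:R * cyc R n i j.
    rewrite (sum_wcount w predT (fun i => \sum_t' cyc R n i (w t'))) wa.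
    apply: eq_bigr => i _; rewrite (sum_wcount w predT (fun j => cyc R n i j)) wa mulr_sumr.
    by apply: eq_bigr => j _; rewrite mulrA.
  by rewrite -sum_weight; apply: cyc_quad.
have bd : \sum_(w in words) \sum_s' \sum_t' cyc R n (w s') (w t') <=
    #|words|%:R * ((n.+1%:R ^+ 2 - 1) / 6%:R * k%:R ^+ 2).
  by rewrite mulr_natl -sumr_const; apply: ler_sum.
rewrite -tot in bd.
have k0 : 0 < k%:R :> R by rewrite ltr0n ltnW.
rewrite -(ler_pM2l k1) -(ler_pM2l k0); apply: le_trans bd _.
by rewrite le_eqVlt; apply/orP; left; apply/eqP; field; rewrite gt_eqF.
Qed.

(* Replacing a letter drawn afresh by the next letter of the word only matters
   when the fresh letter repeats the one in position t < j; swapping positions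
   t and j symmetrises the error into a second difference. *)
Lemma blend_step (j : nat) F (C Z : R) : (j < k)%N -> 0 <= C ->
  (forall g u v, (mdeg g + 1 = j)%N -> `|diff2 F g u v| <= C * cyc R n u v) ->
  (forall s t : 'I_k, (s < t)%N -> \sum_(w in words) cyc R n (w s) (w t) <= Z) ->
  `|\sum_(w in words) blend (fun i => (a i)%:R) F (wcount w (fun t => t < j)%N)
    - k%:R * \sum_(w in words) F (wcount w (fun t => t < j.+1)%N)|
  <= j%:R * (C * Z / 2%:R).
Proof.
move=> jk C0 FC cycZ; pose o := Ordinal jk.
(* A fresh letter with weights [a i] is the letter at an arbitrary position t of the word; [D t]
   compares it with the letter at position j. *)
pose D (t : 'I_k) := \sum_(w in words)
  (F (addm (wcount w (fun s => s < j)%N) (unitm n (w t)))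
   - F (addm (wcount w (fun s => s < j)%N) (unitm n (w o)))).
have -> : \sum_(w in words) blend (fun i => (a i)%:R) F (wcount w (fun t => t < j)%N)
    - k%:R * \sum_(w in words) F (wcount w (fun t => t < j.+1)%N) = \sum_t D t.
  rewrite /D [RHS]exchange_big mulr_sumr -sumrB; apply: eq_bigr => w /eqP wa /=.
  rewrite sumrB sumr_const card_ord mulr_natl; congr (_ - _ *+ _).
    by rewrite (sum_wcount w predT (fun i => F (addm _ (unitm n i)))) wa.
  rewrite [in LHS](wcountD1 w (t := o)) //=; congr (F (addm _ _)).
  by apply: eq_wcount => s /=; rewrite ltnS -val_eqE /= ltn_neqAle andbC.
(* Here the swap of t and j leaves the first j positions alone. *)
have big_t (t : 'I_k) : (j <= t)%N -> D t = 0.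
  move=> jt; rewrite /D sumrB [X in X - _](sum_words_perm (tperm t o)).
  apply/eqP; rewrite subr_eq0; apply/eqP; apply: eq_bigr => w _.
  rewrite wcount_perm tpermV ffunE tpermL; congr (F (addm _ _)).
  apply: eq_wcount => s; case: tpermP => [->|->|] //=.
    by rewrite ltnn ltnNge jt.
  by rewrite ltnn ltnNge jt.
have small_t (t : 'I_k) : (t < j)%N -> `|D t| <= C * Z / 2%:R.
  move=> tj; pose c w := wcount w (fun s : 'I_k => (s < j)%N && (s != t)).
  have cs w : c [ffun s => w (tperm t o s)] = c w.
    rewrite /c wcount_perm tpermV; apply: eq_wcount => s.
    case: tpermP => [->|->|] //=; first by rewrite ltnn eqxx andbF.
    by rewrite eqxx andbF ltnn.
  have -> : D t = (\sum_(w in words) diff2 F (c w) (w t) (w o)) / 2%:R.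
    (* The count [c w], which omits position t, is invariant under the swap; hence [A] and [B] have
       equal sums, and A - E has the sum of (A + B - 2 E) / 2. *)
    pose A w := F (addm (c w) (addm (unitm n (w t)) (unitm n (w t)))).
    pose B w := F (addm (c w) (addm (unitm n (w o)) (unitm n (w o)))).
    pose E w := F (addm (c w) (addm (unitm n (w t)) (unitm n (w o)))).
    have DE : D t = \sum_(w in words) A w - \sum_(w in words) E w.
      by rewrite /D -sumrB; apply: eq_bigr => w _; rewrite (wcountD1 w tj) -!addmA.
    have AB : \sum_(w in words) A w = \sum_(w in words) B w.
      rewrite (sum_words_perm (tperm t o)); apply: eq_bigr => w _.
      by rewrite /A /B cs !ffunE tpermL.
    rewrite /diff2 sumrB big_split /= -/(A _) -mulr_sumr.
    by rewrite -[X in _ + X - _]AB DE; field.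
  rewrite normrM (ger0_norm (x := 2%:R^-1)) ?invr_ge0 ?ler0n //.
  apply: ler_wpM2r; first by rewrite invr_ge0 ler0n.
  apply: le_trans (ler_norm_sum _ _ _) _.
  apply: le_trans (ler_wpM2l C0 (cycZ t o tj)); rewrite mulr_sumr.
  apply: ler_sum => w _; apply: FC.
  have := mdeg_wcount w (fun s : 'I_k => s < j)%N.
  rewrite (wcountD1 w tj) mdegD mdeg_unitm => ->.
  exact/card_ord_lt/ltnW.
apply: le_trans (ler_norm_sum _ _ _) _.
apply: (@le_trans _ _ (\sum_(t < k) if (t < j)%N then C * Z / 2%:R else 0)).
  by apply: ler_sum => t _; case: ltnP => [/small_t //|/big_t ->]; rewrite normr0 lexx.
rewrite -big_mkcond -(big_ord_widen k (fun=> C * Z / 2%:R)) ?(ltnW jk) //.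
by rewrite sumr_const card_ord mulr_natl.
Qed.

End Exchange.

(** * Telescoping over the l draws *)

Section Gap.
Variables (R : rcfType) (n l k : nat) (a : mindex n) (b : mindex n -> R).
Hypotheses (lk : (l < k)%N) (ak : a \in mindices n k).

Let words := [pred w : {ffun 'I_k -> 'I_n.+1} | wcount w predT == a].
Let T := blend (fun i => (a i)%:R : R).

Lemma words_gap :
  `|#|words|%:R * iter l T b (zerom n)
    - k%:R ^+ l * \sum_(w in words) b (wcount w (fun t => t < l)%N)| <=
  #|words|%:R * k%:R ^+ l * ((n * (n + 2) * (l * (l - 1)))%:R
     / (24%:R * (k%:R - 1)) * nabla2_norm l b).
Proof.
pose M := nabla2_norm l b; have M0 : 0 <= M by apply: nabla2_norm_ge0.
pose Z : R := #|words|%:R * (k%:R * (n.+1%:R ^+ 2 - 1) / (6%:R * (k%:R - 1))).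
(* Hybrid scheme: m letters from the word, then l - m drawn with replacement, without
   normalisation. *)
pose S m := \sum_(w in words) iter (l - m) T b (wcount w (fun t => t < m)%N).
have S0 : S 0%N = #|words|%:R * iter l T b (zerom n).
  rewrite /S subn0 mulr_natl -sumr_const; apply: eq_bigr => w _; congr (iter _ _ _ _).
  by apply/ffunP => i; rewrite !ffunE big_pred0.
have Sl : S l = \sum_(w in words) b (wcount w (fun t => t < l)%N) by rewrite /S subnn.
have step m : (m < l)%N ->
    `|S m - k%:R * S m.+1| <= m%:R * (k%:R ^+ (l - m.+1) * M * Z / 2%:R).
  move=> ml; rewrite /S -(subnSK ml) /= -/T.
  apply: blend_step => //; first exact: ltn_trans ml lk.
  - by rewrite mulr_ge0 ?exprn_ge0.
  - move=> g u v dg; rewrite -mulrA -(sum_weight R ak).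
    apply: (@diff2_blend _ _ _ _ l) => [i|h dh|]; first by rewrite ler0n.
      by apply: diff2_le => i j ij; apply: nabla2_norm_ge.
    lia.
  - move=> s t st; apply: sum_words_cyc => //.
    by rewrite -val_eqE /= neq_ltn st.
(* The step bounds add up 0 + ... + (m - 1) = m (m - 1) / 2, each halved, whence the 4; the 6 in [Z]
   turns it into 24, and N^2 - 1 = n (n + 2). *)
have tele m : (m <= l)%N ->
    `|S 0%N - k%:R ^+ m * S m| <= (m * (m - 1))%:R * (k%:R ^+ (l - 1) * M * Z / 4%:R).
  elim: m => [|m IH] ml; first by rewrite expr0 mul1r subrr normr0 mul0r.
  have -> : S 0%N - k%:R ^+ m.+1 * S m.+1 =
      (S 0%N - k%:R ^+ m * S m) + k%:R ^+ m * (S m - k%:R * S m.+1).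
    by rewrite exprS; ring.
  apply: le_trans (ler_normD _ _) _; apply: le_trans (lerD (IH (ltnW ml)) (lexx _)) _.
  rewrite normrM ger0_norm ?exprn_ge0 //.
  apply: le_trans (lerD (lexx _) (ler_wpM2l _ (step m ml))) _; first by rewrite exprn_ge0.
  have -> : (l - 1 = m + (l - m.+1))%N by lia.
  rewrite exprD le_eqVlt; apply/orP; left; apply/eqP.
  have -> : (m.+1 * (m.+1 - 1) = m * (m - 1) + 2 * m)%N by nia.
  by rewrite natrD natrM; field.
rewrite -S0 -Sl; apply: le_trans (tele l (leqnn l)) _.
(* For l = 0 the denominator k - 1 may vanish, but both sides are 0. *)
case: (posnP l) => [l0|l0].
  have -> : (l * (l - 1) = 0)%N by rewrite l0.
  by rewrite muln0 !mul0r mulr0.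
have k1 : 0 < k%:R - 1 :> R by rewrite subr_gt0 ltr1n (leq_ltn_trans l0 lk).
have -> : k%:R ^+ l = k%:R * k%:R ^+ (l - 1) :> R by rewrite -exprS subn1 prednK.
rewrite /Z !natrM natrD -[n.+1%:R]natr1 -/M.
by rewrite le_eqVlt; apply/orP; left; apply/eqP; field; rewrite gt_eqF.
Qed.

(** The hypothesis makes [bk] the mean of [b] over the words, so [words_gap] can be divided by k^l
    times the number of words, positive by [word_of_mindex]. *)
Lemma bernstein_gap (bk : R) :
  \sum_(w in words) (bk - b (wcount w (fun t => t < l)%N)) = 0 ->
  `|iter l (blend (fun i => k%:R^-1 * (a i)%:R)) b (zerom n) - bk| <=
  (n * (n + 2) * (l * (l - 1)))%:R / (24%:R * (k%:R - 1)) * nabla2_norm l b.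
Proof.
rewrite sumrB sumr_const -(mulr_natl bk) => /eqP; rewrite subr_eq0 => /eqP bkE.
have k0 : 0 < k%:R :> R by rewrite ltr0n (leq_ltn_trans _ lk).
have W0 : 0 < #|words|%:R :> R.
  by rewrite ltr0n; apply/card_gt0P; have [w wa] := word_of_mindex R ak; exists w.
have := words_gap; rewrite -bkE blendZ exprVn -/T.
have -> : #|words|%:R * iter l T b (zerom n) - k%:R ^+ l * (#|words|%:R * bk) =
  #|words|%:R * k%:R ^+ l * ((k%:R ^+ l)^-1 * iter l T b (zerom n) - bk).
  by field; rewrite expf_eq0 (gt_eqF k0) andbF.
have W1 : 0 < #|words|%:R * k%:R ^+ l :> R by rewrite mulr_gt0 ?exprn_gt0.
by rewrite normrM (gtr0_norm W1) ler_pM2l.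
Qed.

End Gap.

(** * Evaluation and degree elevation of Bernstein forms *)

Section BernsteinForm.
Variables (R : rcfType) (n : nat).
Implicit Types (y : 'I_n.+1 -> R) (x : 'I_n -> R) (b : mindex n -> R).

Lemma eq_blend y y' m b g : y =1 y' -> iter m (blend y) b g = iter m (blend y') b g.
Proof.
move=> e; elim: m g => //= m IH g; apply: eq_bigr => i _.
by rewrite e IH.
Qed.

Lemma sum_bary x : \sum_i bary x i = 1.
Proof.
rewrite big_ord_recl /bary unlift_none.
by under [X in _ + X]eq_bigr => i _ do rewrite liftK; rewrite subrK.
Qed.

Lemma bary_ge0 x : in_simplex x -> forall i, 0 <= bary x i.
Proof.
case=> x0 x1 i; rewrite /bary; case: unliftP => [j _|_] //.
by rewrite subr_ge0.
Qed.

Definition affine_point y : 'I_n -> R := fun j => y (lift ord0 j).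

Lemma bary_affine y : \sum_i y i = 1 -> bary (affine_point y) =1 y.
Proof.
move=> y1 i; rewrite /bary; case: unliftP => [j ->|->] //.
by rewrite -y1 big_ord_recl addrK.
Qed.

Lemma affine_in_simplex y :
  (forall i, 0 <= y i) -> \sum_i y i = 1 -> in_simplex (affine_point y).
Proof.
move=> y0 y1; split=> [i|]; first exact: y0.
by rewrite -y1 [leRHS]big_ord_recl lerDr.
Qed.

Lemma bern_coeffsE k (P : ('I_n -> R) -> R) b x :
  is_bern_coeffs k P b -> P x = iter k (blend (bary x)) b (zerom n).
Proof.
move=> -> ; rewrite -sum_monom [LHS]big_seq [RHS]big_seq.
apply: eq_bigr => a; rewrite mem_mindices => /eqP ak.
by rewrite /monom /bern ak.
Qed.

(** Both families represent the same polynomial, so by [word_sum] the weighted word sums agree for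
    every y of sum 1, and [sum_words_eq0] separates them by letter counts. *)
Lemma bern_coeffs_elevate l k P (bl bk : mindex n -> R) : (l <= k)%N ->
  is_bern_coeffs l P bl -> is_bern_coeffs k P bk ->
  forall a, \sum_(w : {ffun 'I_k -> 'I_n.+1} | wcount w predT == a)
    (bk a - bl (wcount w (fun t => t < l)%N)) = 0.
Proof.
move=> lk Hl Hk a.
rewrite -[RHS](@sum_words_eq0 R n k
  (fun w => bk (wcount w predT) - bl (wcount w (fun t => t < l)%N)) _ a).
  by apply: eq_bigr => w /eqP ->.
move=> y y1; under eq_bigr => w _ do rewrite mulrBr.
have Hy := bary_affine y1.
have := word_sum y bl (zerom n) lk; rewrite y1 expr1n mul1r.
rewrite -(eq_blend _ _ _ Hy) -(bern_coeffsE _ Hl) (bern_coeffsE _ Hk) (eq_blend _ _ _ Hy).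
have := word_sum y bk (zerom n) (leqnn k); rewrite y1 expr1n mul1r => <- e.
apply/eqP; rewrite sumrB subr_eq0; apply/eqP.
transitivity (\sum_(w : {ffun 'I_k -> 'I_n.+1}) (\prod_t y (w t)) *
   bk (addm (zerom n) (wcount w (fun t => t < k)%N))).
  apply: eq_bigr => w _; rewrite add0m; congr (_ * bk _).
  by apply: eq_wcount => t; rewrite ltn_ord.
by rewrite -e; apply: eq_bigr => w _; rewrite add0m.
Qed.

End BernsteinForm.

(** * Minimum and maximum of a list *)

Section Extrema.
Variable R : rcfType.
Implicit Types s : seq R.

Lemma minl_le s z : z \in s -> minl s <= z.
Proof.
rewrite /minl; move: (head 0 s) => d.
by elim: s => //= u s IH; rewrite inE ge_min => /orP[/eqP ->|/IH ->];
  rewrite ?lexx ?orbT.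
Qed.

Lemma maxl_ge s z : z \in s -> z <= maxl s.
Proof.
rewrite /maxl; move: (head 0 s) => d.
by elim: s => //= u s IH; rewrite inE le_max => /orP[/eqP ->|/IH ->];
  rewrite ?lexx ?orbT.
Qed.

Lemma minl_in s : s != [::] -> minl s \in s.
Proof.
case: s => // u s _; rewrite /minl.
(* The starting value stays the head of the whole list while the folded list varies in the
   induction. *)
suff h t : foldr Num.min (head 0 (u :: s)) t \in u :: t.
  by have := h (u :: s); rewrite inE => /orP[/eqP ->|//]; rewrite mem_head.
elim: t => [|v t IH]; first by rewrite mem_head.
rewrite /= /Num.min; case: ifP => _; first by rewrite !inE eqxx orbT.
by move: IH; rewrite !inE => /orP[->//|->]; rewrite !orbT.
Qed.

Lemma maxl_in s : s != [::] -> maxl s \in s.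
Proof.
case: s => // u s _; rewrite /maxl.
suff h t : foldr Num.max (head 0 (u :: s)) t \in u :: t.
  by have := h (u :: s); rewrite inE => /orP[/eqP ->|//]; rewrite mem_head.
elim: t => [|v t IH]; first by rewrite mem_head.
rewrite /= /Num.max; case: ifP => _; last by rewrite !inE eqxx orbT.
by move: IH; rewrite !inE => /orP[->//|->]; rewrite !orbT.
Qed.

End Extrema.

(** * Enclosures of quotients by quotients of coefficients *)

Section RationalForm.
Variables (R : rcfType) (n : nat).
Implicit Types (bp bq : mindex n -> R) (y : 'I_n.+1 -> R) (x : 'I_n -> R).

Lemma blend_ge_min b k y : (forall i, 0 <= y i) -> \sum_i y i = 1 ->
  minl [seq b a | a <- mindices n k] <= iter k (blend y) b (zerom n) :> R.
Proof.
move=> y0 y1; set mb := minl _.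
rewrite -subr_ge0 -(blend_const k mb (zerom n) y1) -[iter _ _ b _]mul1r -mulN1r.
rewrite -blend_lincomb; apply: blend_ge0 => // a; rewrite mdeg0 addn0 => da.
by rewrite mul1r mulN1r subr_ge0 minl_le // map_f // mem_mindices da.
Qed.

(* If p/q has coefficients bp/bq, then p - m q has coefficients (bp/bq - m) bq,
   which are nonnegative for m the least of the quotients. *)
Lemma blend_enclosure bp bq k y : (forall i, 0 <= y i) ->
  (forall a, a \in mindices n k -> 0 < bq a) ->
  let s := [seq bp a / bq a | a <- mindices n k] in
  let p := iter k (blend y) bp (zerom n) in
  let q := iter k (blend y) bq (zerom n) in
  minl s * q <= p /\ p <= maxl s * q.
Proof.
move=> y0 q0 s p q; have mem_s a : mdeg a = k -> 0 < bq a /\ bp a / bq a \in s.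
  move=> /eqP da; have ak : a \in mindices n k by rewrite mem_mindices.
  by split; [exact: q0|exact: map_f].
split; rewrite -subr_ge0.
  rewrite -[p]mul1r -mulNr -blend_lincomb; apply: blend_ge0 => // a.
  rewrite mdeg0 addn0 => /mem_s[qa ins].
  by rewrite mul1r mulNr subr_ge0 -ler_pdivlMr // minl_le.
rewrite -mulN1r -blend_lincomb; apply: blend_ge0 => // a.
rewrite mdeg0 addn0 => /mem_s[qa ins].
by rewrite mulN1r subr_ge0 -ler_pdivrMr // maxl_ge.
Qed.

(** [pk] and [qk] are means of [bp] and [bq] over the same words, so [pk / qk] is a mean of the
    quotients with positive weights [bq]. This carries the bound by zeta from degree l to degree
    k. *)
Lemma elevate_enclosure bp bq (l k : nat) (a : mindex n) (pk qk : R) :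
  (l < k)%N -> a \in mindices n k ->
  (forall a, a \in mindices n l -> 0 < bq a) -> 0 < qk ->
  \sum_(w : {ffun 'I_k -> 'I_n.+1} | wcount w predT == a)
    (pk - bp (wcount w (fun t => t < l)%N)) = 0 ->
  \sum_(w : {ffun 'I_k -> 'I_n.+1} | wcount w predT == a)
    (qk - bq (wcount w (fun t => t < l)%N)) = 0 ->
  minl [seq bp a / bq a | a <- mindices n l] <= pk / qk <=
  maxl [seq bp a / bq a | a <- mindices n l].
Proof.
set s := [seq _ | _ <- _].
move=> lk ak q0 qk0; rewrite !sumrB !sumr_const.
set W := #|_| => /eqP; rewrite subr_eq0 => /eqP pE /eqP; rewrite subr_eq0 => /eqP qE.
have W0 : (0 < W)%N.
  by apply/card_gt0P; have [w wa] := word_of_mindex R ak; exists w.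
have mem_s (w : {ffun 'I_k -> 'I_n.+1}) : let c := wcount w (fun t => t < l)%N in
    0 < bq c /\ bp c / bq c \in s.
  have cl : wcount w (fun t => t < l)%N \in mindices n l.
    by rewrite mem_mindices mdeg_wcount card_ord_lt // ltnW.
  by split; [exact: q0|exact: map_f].
rewrite ler_pdivlMr // ler_pdivrMr // -(ler_pMn2r W0) -[X in _ && X](ler_pMn2r W0).
rewrite -!mulrnAr pE qE !mulr_sumr; apply/andP; split; apply: ler_sum => w _;
  have [qc ins] := mem_s w.
  by rewrite -ler_pdivlMr // minl_le.
by rewrite -ler_pdivrMr // maxl_ge.
Qed.

End RationalForm.

(** * Distance between the range of f and its Bernstein enclosure *)

Unset Implicit Arguments. Set Strict Implicit.

Theorem theorem4p3 (R : rcfType) (n l : nat)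
    (cp cq : expo n -> R)
    (Hdp : has_total_degree l cp) (Hdq : has_total_degree l cq)
    (bp bq : nat -> mindex n -> R)
    (Hbp : forall j, (l <= j)%N -> is_bern_coeffs j (poly_eval l cp) (bp j))
    (Hbq : forall j, (l <= j)%N -> is_bern_coeffs j (poly_eval l cq) (bq j))
    (Hpos : forall j, (l <= j)%N -> forall a, a \in mindices n j -> 0 < bq j a)
    (x0 x1 : 'I_n -> R)
    (Hx0 : in_simplex x0) (Hx1 : in_simplex x1)
    (Hmin : forall y, in_simplex y ->
       poly_eval l cp x0 / poly_eval l cq x0 <= poly_eval l cp y / poly_eval l cq y)
    (Hmax : forall y, in_simplex y ->
       poly_eval l cp y / poly_eval l cq y <= poly_eval l cp x1 / poly_eval l cq x1)
    (k : nat) (Hk : (l < k)%N) :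
  let f := fun x => poly_eval l cp x / poly_eval l cq x in
  let bfl := [seq bp l a / bq l a | a <- mindices n l] in
  let bfk := [seq bp k a / bq k a | a <- mindices n k] in
  let zeta := Num.max `|minl bfl| `|maxl bfl| in
  let omega := (n * (n + 2) * (l * (l - 1)))%:R
                 / (24%:R * minl [seq bq l a | a <- mindices n l])
               * (nabla2_norm l (bp l) + zeta * nabla2_norm l (bq l)) in
  Num.max `|f x0 - minl bfk| `|f x1 - maxl bfk| <= omega / (k%:R - 1).
Proof.
pose f x := poly_eval l cp x / poly_eval l cq x.
pose bfl := [seq bp l a / bq l a | a <- mindices n l].
pose bfk := [seq bp k a / bq k a | a <- mindices n k].
pose zeta := Num.max `|minl bfl| `|maxl bfl|.
pose omega := (n * (n + 2) * (l * (l - 1)))%:R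
                / (24%:R * minl [seq bq l a | a <- mindices n l])
              * (nabla2_norm l (bp l) + zeta * nabla2_norm l (bq l)).
change (Num.max `|f x0 - minl bfk| `|f x1 - maxl bfk| <= omega / (k%:R - 1)).
pose m := minl [seq bq l a | a <- mindices n l].
have nonempty (b : mindex n -> R) j : [seq b a | a <- mindices n j] != [::].
  have [a] := head_mindices n j; apply: contraL => /eqP e.
  by have /= := size_map b (mindices n j); rewrite e; case: (mindices n j).
have m0 : 0 < m.
  by rewrite /m; have /mapP[a al ->] := minl_in (nonempty (bq l) l); exact: Hpos.
have q_ge x : in_simplex x -> m <= poly_eval l cq x.
  move=> xs; rewrite (bern_coeffsE _ (Hbq l (leqnn l))).
  by apply: blend_ge_min; [exact: bary_ge0|exact: sum_bary].
have q_gt0 x : in_simplex x -> 0 < poly_eval l cq x.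
  by move=> /q_ge; apply: lt_le_trans.
have enclosure x : in_simplex x -> minl bfk <= f x <= maxl bfk.
  move=> xs; have [lo hi] := blend_enclosure (bp k) (bary_ge0 xs) (Hpos k (ltnW Hk)).
  rewrite ler_pdivlMr ?q_gt0 // ler_pdivrMr ?q_gt0 //.
  rewrite (bern_coeffsE _ (Hbp k (ltnW Hk))) (bern_coeffsE _ (Hbq k (ltnW Hk))).
  by rewrite lo hi.
have k0 : 0 < k%:R :> R by rewrite ltr0n (leq_ltn_trans _ Hk).
(* Each coefficient of f is compared with f at the grid point with barycentric coordinates a / k. *)
have close a : a \in mindices n k -> exists2 x, in_simplex x &
    `|f x - bp k a / bq k a| <= omega / (k%:R - 1).
  move=> ak; pose y (i : 'I_n.+1) : R := k%:R^-1 * (a i)%:R.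
  have y0 i : 0 <= y i by rewrite mulr_ge0 ?invr_ge0 ?ler0n.
  have y1 : \sum_i y i = 1 by rewrite -mulr_sumr (sum_weight R ak) mulVf ?gt_eqF.
  exists (affine_point y); first exact: affine_in_simplex.
  set x := affine_point y; have xs : in_simplex x by exact: affine_in_simplex.
  have pE : poly_eval l cp x = iter l (blend y) (bp l) (zerom n).
    by rewrite (bern_coeffsE _ (Hbp l (leqnn l))) (eq_blend _ _ _ (bary_affine y1)).
  have qE : poly_eval l cq x = iter l (blend y) (bq l) (zerom n).
    by rewrite (bern_coeffsE _ (Hbq l (leqnn l))) (eq_blend _ _ _ (bary_affine y1)).
  have elp := bern_coeffs_elevate (ltnW Hk) (Hbp l (leqnn l)) (Hbp k (ltnW Hk)) a.
  have elq := bern_coeffs_elevate (ltnW Hk) (Hbq l (leqnn l)) (Hbq k (ltnW Hk)) a.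
  have gp := bernstein_gap Hk ak elp; have gq := bernstein_gap Hk ak elq.
  rewrite -/y -pE in gp; rewrite -/y -qE in gq.
  have bq0 := Hpos k (ltnW Hk) a ak.
  have fz : `|bp k a / bq k a| <= zeta.
    have /andP[lo hi] := elevate_enclosure Hk ak (Hpos l (leqnn l)) bq0 elp elq.
    rewrite /zeta -/bfl in lo hi *; rewrite le_max.
    move: (bp k a / bq k a) lo hi => r lo hi.
    case: (lerP 0 r) => r0; first by rewrite (ger0_norm r0) (ger0_norm (le_trans r0 hi)) hi orbT.
    by rewrite (ltr0_norm r0) (ltr0_norm (le_lt_trans lo r0)) lerN2 lo.
  move: gp gq fz; rewrite /f; set p := poly_eval l cp x; set q := poly_eval l cq x.
  set K := _ / (24%:R * _); set r := bp k a / bq k a => gp gq fz.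
  have K0 : 0 <= K.
    rewrite divr_ge0 ?ler0n // mulr_ge0 // subr_ge0 ler1n.
    exact: leq_ltn_trans Hk.
  have mq : m <= q by exact: q_ge.
  have q0 : 0 < q by exact: q_gt0.
  have -> : p / q - r = ((p - bp k a) - r * (q - bq k a)) / q.
    by rewrite /r; field; rewrite !gt_eqF.
  (* [K] is the common factor of the two polynomial gaps; the minimum [m] in [omega] comes from q(x)
     >= m. *)
  have -> : omega / (k%:R - 1) =
      (K * nabla2_norm l (bp l) + zeta * (K * nabla2_norm l (bq l))) / m.
    by rewrite /omega /K -/m !invfM; ring.
  rewrite normrM normfV (gtr0_norm q0).
  have num : `|p - bp k a - r * (q - bq k a)| <=
      K * nabla2_norm l (bp l) + zeta * (K * nabla2_norm l (bq l)).
    apply: le_trans (ler_normB _ _) _; apply: lerD => //.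
    by rewrite normrM; apply: ler_pM.
  apply: ler_pM => //; first by rewrite invr_ge0 ltW.
  by rewrite lef_pV2.
have /mapP[a ak aE] := minl_in (nonempty (fun a => bp k a / bq k a) k).
have /mapP[c ck cE] := maxl_in (nonempty (fun a => bp k a / bq k a) k).
rewrite ge_max; apply/andP; split.
  (* At an index attaining the minimum: the enclosure removes the absolute value, and the minimality
     of [x0] replaces [f x0] by [f x]. The maximum is symmetric. *)
  have [x xs] := close a ak; rewrite -aE -/bfk => gap.
  have /andP[lo _] := enclosure _ Hx0; rewrite ger0_norm ?subr_ge0 //.
  apply: le_trans (le_trans (ler_norm _) gap).
  by rewrite lerD2r; apply: Hmin.
have [x xs] := close c ck; rewrite -cE -/bfk distrC => gap.
have /andP[_ hi] := enclosure _ Hx1; rewrite ler0_norm ?subr_le0 // opprB.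
apply: le_trans (le_trans (ler_norm _) gap).
by rewrite lerD2l lerN2; apply: Hmax.
Qed.
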